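(* Let $G$ be a group, let $(\Gamma,\psi)$ be a $G$-gain graph, let $\pi$ be a unitary representation of $G$ (of finite degree), let $s\in G$ be such that $\pi(s)=-I$, and let $\alpha=\{C_0,C_1,\ldots,C_k\}$ be a $\pi$-GM partition of $V_\Gamma$ (in the weakened sense defined in the context), with associated matrix $Q_\alpha$ and associated switched gain graph $(\Gamma,\psi)^{\alpha,s}=(\Gamma^{\alpha,s},\psi^{\alpha,s})$. Then $$\pi(A_{(\Gamma^{\alpha,s},\psi^{\alpha,s})})=\pi(Q_\alpha)\,\pi(A_{(\Gamma,\psi)})\,\pi(Q_\alpha).$$ In particular, $(\Gamma,\psi)$ and $(\Gamma,\psi)^{\alpha,s}$ are $\pi$-cospectral.
   Context: **Group algebra and representations.** $G$ is an arbitrary group with unit $1_G$; $\mathbb{C}G$ is its group algebra; $M_n(\mathbb{C}G)$ the algebra of $n\times n$ matrices over it. A representation of degree $d$ is a homomorphism $\pi\colon G\to GL_d(\mathbb{C})$; it is unitary if all $\pi(g)$ are unitary matrices. $\pi$ is extended linearly to $\pi\colon\mathbb{C}G\to M_d(\mathbb{C})$, and then to $\pi\colon M_n(\mathbb{C}G)\to M_{nd}(\mathbb{C})$ by replacing each entry $a_{i,j}$ with the $d\times d$ block $\pi(a_{i,j})$. $I$ is the identity matrix. **Gain graphs.** $\Gamma=(V_\Gamma,E_\Gamma)$ is a finite simple graph; $u\sim v$ means $u,v$ are adjacent. A $G$-gain graph $(\Gamma,\psi)$ consists of $\Gamma$ and a map $\psi$ from ordered pairs of adjacent vertices to $G$ with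 $\psi(u,v)=\psi(v,u)^{-1}$. Fixing an ordering $v_1,\dots,v_n$ of $V_\Gamma$, its adjacency matrix $A_{(\Gamma,\psi)}\in M_n(\mathbb{C}G)$ has $(i,j)$ entry $\psi(v_i,v_j)$ if $v_i\sim v_j$ and $0$ otherwise. For $\pi$ unitary, $\pi(A_{(\Gamma,\psi)})$ is a Hermitian complex matrix; its spectrum (with multiplicities) is the $\pi$-spectrum of $(\Gamma,\psi)$. Two $G$-gain graphs are $\pi$-cospectral if they have the same $\pi$-spectrum. **$\pi$-GM partition (weakened sense).** For a partition $\alpha=\{C_0,C_1,\dots,C_k\}$ of $V_\Gamma$ and $v\in V_\Gamma$, put $\Psi_i(v)=\sum_{w\in C_i,\,w\sim v}\psi(v,w)\in\mathbb{C}G$. $\alpha$ is a $\pi$-GM partition if: - for all $i,j\in\{1,\dots,k\}$ and all $v,v'\in C_i$, $\pi(\Psi_j(v))=\pi(\Psi_j(v'))$; - for every $v\in C_0$ and every $i\in\{1,\dots,k\}$, at least one of the following holds: (1) there exist $g_1,g_2\in G\cup\{0\}\subset\mathbb{C}G$ such that $\Psi_i(v)=\frac{|C_i|}{2}g_1+\frac{|C_i|}{2}g_2$; (2) there exists $s\in G$ such that $\pi(s)=-I$, and $\pi(\Psi_i(v))=0$. **Switched graph.** Given $s\in G$ with $\pi(s)=-I$, $(\Gamma,\psi)^{\alpha,s}=(\Gamma^{\alpha,s},\psi^{\alpha,s})$ is the $G$-gain graph on the same vertex set such that: - adjacencies and gains between pairs of vertices of $\bigcup_{i=1}^k C_i$,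 and between pairs of vertices of $C_0$, are the same as in $(\Gamma,\psi)$; - for $v\in C_0$ and $i\in\{1,\dots,k\}$: if (1) holds with $g_1,g_2\in G\cup\{0\}$, then for every $w\in C_i$ one sets $\psi^{\alpha,s}(v,w)=g_1$ if $\psi(v,w)=g_2$ and $\psi^{\alpha,s}(v,w)=g_2$ if $\psi(v,w)=g_1$, with the convention that the value $0$ means the two vertices are not adjacent; if (1) does not hold (so (2) holds and $\pi(\Psi_i(v))=0$), then adjacencies between $v$ and $C_i$ are unchanged and $\psi^{\alpha,s}(v,w)=s\,\psi(v,w)$ for $w\in C_i$, $w\sim v$. In all cases $\psi^{\alpha,s}(w,v)=\psi^{\alpha,s}(v,w)^{-1}$. The same vertex ordering is used for both adjacency matrices. **Matrix $Q_\alpha$.** With $n_i=|C_i|$, $Q_\alpha\in M_n(\mathbb{C}G)$ is indexed by $V_\Gamma$ with entries $(Q_\alpha)_{u,v}=1_G$ if $u=v\in C_0$; $\frac{2-n_i}{n_i}1_G$ if $u=v\in C_i$, $i\ge1$; $\frac{2}{n_i}1_G$ if $u\neq v$, $u,v\in C_i$, $i\ge 1$; and $0$ otherwise. *)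

(* Defs.v *)
From HB Require Import structures.
From mathcomp Require Import all_boot all_order all_fingroup all_algebra.
From mathcomp Require Import spectral finmap multiset boolp.
From mathcomp Require Import monalg.

Set Implicit Arguments.
Unset Strict Implicit.
Unset Printing Implicit Defensive.

Import GRing.Theory Num.Theory.
Local Open Scope ring_scope.

(* C stands for the field of complex numbers. The group algebra CG is the     *)
(* free C-module {malg C[G]} on G, the basis element g being << g >>; its     *)
(* product is never needed below.                                             *)

Section Representations.
Variables (C : numClosedFieldType) (G : groupType) (d : nat).

(* Every rep g is invertible, with inverse rep g^-1, by the two axioms. *)
Record representation := Representation {
  rep :> G -> 'M[C]_d;
  rep1 : rep 1%g = 1%:M;
  repM : forall g h : G, rep (g * h)%g = rep g *m rep h }.

Definition unitary_rep (pi : representation) : Prop :=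
  forall g : G, pi g \is unitarymx.

Definition rep_alg (pi : representation) (a : {malg C[G]}) : 'M[C]_d :=
  \sum_(g <- msupp a) a@_g *: pi g.

Definition rep_mx (n : nat) (pi : representation) (A : 'M[{malg C[G]}]_n) :
    'M[C]_(\sum_(i < n) d) :=
  \mxblock_(i < n, j < n) rep_alg pi (A i j).

End Representations.

(* The eigenvalues, counted with algebraic multiplicity. *)
Definition spectrum (C : numClosedFieldType) (m : nat) (A : 'M[C]_m) :
    {mset C}%mset :=
  seq_mset (sval (closed_field_poly_normal (char_poly A))).

(* The values of gain on non-adjacent pairs are irrelevant. *)
Record gain_graph (G : groupType) (V : finType) := GainGraph {
  adj : rel V;
  gain : V -> V -> G;
  adj_irr : irreflexive adj;
  adj_sym : symmetric adj;
  gainV : forall u v, adj u v -> gain u v = ((gain v u)^-1)%g }.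

(* block v = None means v \in C_0. The classes C_1, ..., C_k are indexed by   *)
(* 'I_k and nonempty, whereas C_0 may be empty.                               *)
Record gm_blocks (V : finType) (k : nat) := GMBlocks {
  block : V -> option 'I_k;
  block_neq0 : forall i : 'I_k, exists v : V, block v = Some i }.

Definition cell (V : finType) (k : nat) (al : gm_blocks V k) (i : 'I_k) :
    {set V} := [set v | block al v == Some i].

Lemma option_count2 (T : eqType) (p q p' q' : option T) :
  (forall x, (p == Some x) + (q == Some x) =
             (p' == Some x) + (q' == Some x))%N ->
  (p', q') = (p, q) \/ (p', q') = (q, p).
Proof.
have ext (y z : option T) :
    (forall x, (y == Some x) = (z == Some x) :> nat) -> y = z.
  case: y z => [y|] [z|] // yz; last by have := yz z; rewrite eqxx.
    by have := yz y; rewrite eqxx; case: eqP => // ->.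
  by have := yz y; rewrite eqxx.
have [-> E|p'p] := eqVneq p' p.
  by left; congr (_, _); apply: ext => x; have /addnI -> := E x.
have [-> E|p'q] := eqVneq p' q.
  right; congr (_, _); apply: ext => x.
  by have := E x; rewrite addnC => /addnI ->.
case: p' p'p p'q => [x|] p'p p'q E.
  by have := E x; rewrite eqxx eq_sym (negPf p'p) eq_sym (negPf p'q).
case: p q p'p p'q E => [a|] [b|] // _ _ E.
have := E a; rewrite eqxx; case: (eqVneq q' (Some a)) => // q'E.
have := E b; rewrite eqxx q'E.
by case: (eqVneq (Some b) (Some a)).
Qed.

Section GainGraphs.
Variables (C : numClosedFieldType) (G : groupType) (V : finType).
Local Notation CG := {malg C[G]}.

(* option G stands for the subset G \cup {0} of CG, with None as 0. *)
Definition galg0 (x : option G) : CG := if x is Some g then << g >> else 0.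

Definition gain0 (Ga : gain_graph G V) (u v : V) : option G :=
  if adj Ga u v then Some (gain Ga u v) else None.

Definition adjacency_mx (n : nat) (vord : 'I_n -> V) (Ga : gain_graph G V) :
    'M[CG]_n :=
  \matrix_(i, j) galg0 (gain0 Ga (vord i) (vord j)).

Definition pi_spectrum (d n : nat) (pi : representation C G d)
    (vord : 'I_n -> V) (Ga : gain_graph G V) : {mset C}%mset :=
  spectrum (rep_mx pi (adjacency_mx vord Ga)).

Section Partition.
Variables (k : nat) (al : gm_blocks V k).

Definition gain_sum (Ga : gain_graph G V) (i : 'I_k) (v : V) : CG :=
  \sum_(w in cell al i | adj Ga v w) << gain Ga v w >>.

Definition balanced (Ga : gain_graph G V) (v : V) (i : 'I_k)
    (g : option G * option G) : Prop :=
  gain_sum Ga i v = (#|cell al i|%:R / 2 : C) *: galg0 g.1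
                    + (#|cell al i|%:R / 2 : C) *: galg0 g.2.

Definition gm_partition (d : nat) (pi : representation C G d)
    (Ga : gain_graph G V) : Prop :=
  (forall (i j : 'I_k) (v v' : V), v \in cell al i -> v' \in cell al i ->
     rep_alg pi (gain_sum Ga j v) = rep_alg pi (gain_sum Ga j v')) /\
  (forall (v : V) (i : 'I_k), block al v = None ->
     (exists g : option G * option G, balanced Ga v i g) \/
     ((exists s : G, pi s = - 1%:M) /\ rep_alg pi (gain_sum Ga i v) = 0)).

Definition Qmx_entry (u v : V) : CG :=
  match block al u, block al v with
  | None, None => if u == v then << 1%g >> else 0
  | Some i, Some j =>
      if i != j then 0
      else if u == v
      then ((2 - #|cell al i|%:R) / #|cell al i|%:R : C) *: << 1%g >>
      else (2 / #|cell al i|%:R : C) *: << 1%g >>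
  | _, _ => 0
  end.

Definition Qmx (n : nat) (vord : 'I_n -> V) : 'M[CG]_n :=
  \matrix_(i, j) Qmx_entry (vord i) (vord j).

Definition swap (g : option G * option G) (x : option G) : option G :=
  if x == g.1 then g.2 else if x == g.2 then g.1 else x.

(* The new gain from v \in C_0 to w \in C_i. When a balanced pair exists, it  *)
(* is unique up to order, so that the choice made by cid does not matter; see *)
(* gain0_switched_balanced.                                                   *)
Definition cross_gain (Ga : gain_graph G V) (s : G) (v : V) (i : 'I_k)
    (w : V) : option G :=
  match pselect (exists g, balanced Ga v i g) with
  | left bal => swap (sval (cid bal)) (gain0 Ga v w)
  | right _ => omap (fun g : G => (s * g)%g) (gain0 Ga v w)
  end.

Definition switched_gain0 (Ga : gain_graph G V) (s : G) (u v : V) : option G :=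
  match block al u, block al v with
  | None, Some i => cross_gain Ga s u i v
  | Some i, None => omap (fun g : G => (g^-1)%g) (cross_gain Ga s v i u)
  | _, _ => gain0 Ga u v
  end.

Definition switched_adj (Ga : gain_graph G V) (s : G) : rel V :=
  fun u v => isSome (switched_gain0 Ga s u v).

Definition switched_gain (Ga : gain_graph G V) (s : G) (u v : V) : G :=
  odflt 1%g (switched_gain0 Ga s u v).

Fact switched_gain0V Ga s u v :
  switched_gain0 Ga s u v =
    omap (fun g : G => (g^-1)%g) (switched_gain0 Ga s v u).
Proof.
have gain0V a b : gain0 Ga a b = omap (fun g : G => (g^-1)%g) (gain0 Ga b a).
  rewrite /gain0 adj_sym; case: ifP => //= ba.
  by rewrite gainV // adj_sym.
rewrite /switched_gain0; case: (block al u) => [i|]; case: (block al v) => [j|] //.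
by case: (cross_gain _ _ _ _ _) => //= g; rewrite invgK.
Qed.

Fact switched_irr Ga s : irreflexive (switched_adj Ga s).
Proof.
by move=> u; rewrite /switched_adj /switched_gain0 /gain0 adj_irr; case: (block al u).
Qed.

Fact switched_sym Ga s : symmetric (switched_adj Ga s).
Proof.
by move=> u v; rewrite /switched_adj switched_gain0V; case: (switched_gain0 _ _ _ _).
Qed.

Fact switched_gainV Ga s u v : switched_adj Ga s u v ->
  switched_gain Ga s u v = ((switched_gain Ga s v u)^-1)%g.
Proof.
rewrite /switched_adj /switched_gain switched_gain0V.
by case: (switched_gain0 _ _ _ _).
Qed.

Definition switched (Ga : gain_graph G V) (s : G) : gain_graph G V :=
  GainGraph (@switched_irr Ga s) (@switched_sym Ga s) (@switched_gainV Ga s).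

Lemma gain0_switched Ga s u v :
  gain0 (switched Ga s) u v = switched_gain0 Ga s u v.
Proof.
by rewrite /gain0 /= /switched_adj /switched_gain; case: (switched_gain0 _ _ _ _).
Qed.

Lemma balanced_uniq Ga v i (g h : option G * option G) :
  balanced Ga v i g -> balanced Ga v i h -> h = g \/ h = (g.2, g.1).
Proof.
rewrite /balanced => -> E.
have n0 : (#|cell al i|%:R / 2 : C) != 0.
  apply: mulf_neq0; last by rewrite invr_eq0 pnatr_eq0.
  rewrite pnatr_eq0 cards_eq0; apply/set0Pn.
  by have [w bw] := block_neq0 al i; exists w; rewrite inE bw.
have coefE (y : option G) x : (galg0 y)@_x = (y == Some x)%:R :> C.
  case: y => [a|] /=; last by rewrite mcoeff0.
  by rewrite mcoeffU.
have sumE (c : C) (y z : option G) x :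
    (c *: galg0 y + c *: galg0 z)@_x
    = c * ((y == Some x) + (z == Some x))%:R.
  by rewrite natrD mulrDr -!coefE -!mcoeffZ mcoeffD.
have {}E x : ((g.1 == Some x) + (g.2 == Some x) =
            (h.1 == Some x) + (h.2 == Some x))%N.
  have /(congr1 (mcoeff x)) := E; rewrite !sumE.
  by move/(mulfI n0)/eqP; rewrite eqr_nat => /eqP.
by have := option_count2 E; case: (g) (h) => [? ?] [? ?].
Qed.

Lemma gain0_switched_balanced Ga s v i w (g : option G * option G) :
  block al v = None -> block al w = Some i -> balanced Ga v i g ->
  gain0 (switched Ga s) v w = swap g (gain0 Ga v w).
Proof.
move=> bv bw bal; rewrite gain0_switched /switched_gain0 bv bw /cross_gain.
case: pselect => [ex|[]]; last by exists g.
case: (cid ex) => h /= bal'.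
case: (balanced_uniq bal bal') => -> //; rewrite /swap /=.
by case: eqP => [->|]; case: eqP => // ->.
Qed.

Lemma gain0_switched_unbalanced Ga s v i w :
  block al v = None -> block al w = Some i ->
  ~ (exists g, balanced Ga v i g) ->
  gain0 (switched Ga s) v w = omap (fun g : G => (s * g)%g) (gain0 Ga v w).
Proof.
move=> bv bw nbal; rewrite gain0_switched /switched_gain0 bv bw /cross_gain.
by case: pselect.
Qed.

End Partition.
End GainGraphs.

Definition pi_cospectral (C : numClosedFieldType) (G : groupType) (d : nat)
    (pi : representation C G d) (V V' : finType) (n n' : nat)
    (vord : 'I_n -> V) (Ga : gain_graph G V)
    (vord' : 'I_n' -> V') (Ga' : gain_graph G V') : Prop :=
  pi_spectrum pi vord Ga = pi_spectrum pi vord' Ga'.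

(* Main.v *)
Require Import Defs.
From HB Require Import structures.
From mathcomp Require Import all_boot all_order all_fingroup all_algebra.
From mathcomp Require Import spectral finmap boolp monalg.
From mathcomp Require Import complex reals.

(** On functions from vertices to a vector space, let the cell reflection send
    f to the function equal to f on C_0 and to 2 m_i - f on each C_i, where m_i
    is the mean of f over C_i. It is an involution, because it preserves the
    means m_i, and its matrix, tensored with the d x d identity, is pi(Q). Hence
    pi(Q) is its own inverse, and the (u, v) block of pi(Q) pi(A) pi(Q) is
    obtained by reflecting the block function (x, y) |-> pi(A_{x,y}) once in
    each variable. The theorem compares this double reflection with the
    switched blocks, case by case ([rep_gain_switched]).

    Between vertices of C_0 both are the original block. Between u in C_i and
    v in C_j the double reflection adds to the original block twice the
    difference between the mean of row u over C_j and the mean of column v over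
    C_i. Rows have constant sums by the definition of the partition; columns
    have constant sums too, because pi(A) is Hermitian; so both means equal the
    mean of the whole C_i x C_j submatrix ([cell_sum_balance]), and the
    difference vanishes.

    For v in C_0 and w in C_i only one reflection acts: it replaces the block
    pi(A_{v,w}) by 2 m - pi(A_{v,w}), m being the mean of row v over C_i. In
    case (1), 2 m = pi(g1) + pi(g2), and every gain from v to C_i is g1 or g2
    ([balanced_gain]), so that the difference is the block of the other one of
    the two: gains are swapped. In case (2), m = 0 and the block changes sign,
    which is multiplication of the gain by s ([rep_gain_switched_C0]). Blocks
    from C_i to C_0 follow by taking adjoints.

    Cospectrality holds since conjugating by an involution preserves the
    characteristic polynomial. *)

Set Implicit Arguments.
Unset Strict Implicit.
Unset Printing Implicit Defensive.

Import GRing.Theory Num.Theory.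
Local Open Scope ring_scope.
Local Open Scope sesquilinear_scope.

(** * The linear extension of a representation *)

Section RepAlg.
Variables (C : numClosedFieldType) (G : groupType) (d : nat).
Variable pi : representation C G d.
Implicit Types (a b : {malg C[G]}) (g : G).

Lemma rep_algEw a (D : {fset G}) : (msupp a `<=` D)%fset ->
  rep_alg pi a = \sum_(g <- D) a@_g *: pi g.
Proof.
move=> sD; rewrite /rep_alg (big_fset_incl _ sD) // => g _ ga.
by rewrite mcoeff_outdom // scale0r.
Qed.

Lemma rep_alg_linear : linear (rep_alg pi).
Proof.
move=> c a b; pose D := (msupp a `|` msupp b)%fset.
have sa : (msupp a `<=` D)%fset by apply: fsubsetUl.
have sb : (msupp b `<=` D)%fset by apply: fsubsetUr.
have sab : (msupp (c *: a + b) `<=` D)%fset.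
  by rewrite (fsubset_trans (msuppD_le _ _)) // fsetSU // msuppZ_le.
rewrite (rep_algEw sa) (rep_algEw sb) (rep_algEw sab) scaler_sumr -big_split /=.
by apply: eq_bigr => g _; rewrite mcoeffD mcoeffZ scalerDl scalerA.
Qed.

HB.instance Definition _ :=
  GRing.isLinear.Build C {malg C[G]} 'M[C]_d *:%R (rep_alg pi) rep_alg_linear.

Lemma rep_algU g : rep_alg pi << g >> = pi g.
Proof.
by rewrite (rep_algEw (msuppU_le)) big_seq_fset1 mcoeffUU scale1r.
Qed.

Lemma unitary_repV g : unitary_rep pi -> pi g^-1%g = (pi g)^t*.
Proof.
by move=> U; rewrite -[LHS](mulmxtVK _ (U g)) -repM mulVg rep1 mul1mx.
Qed.

End RepAlg.

(** * Reflecting functions about their cell means *)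

Section Reflection.
Variables (C : numClosedFieldType) (V : finType) (k : nat) (al : gm_blocks V k).

Definition reflect_cells (W : lmodType C) (f : V -> W) (v : V) : W :=
  if block al v is Some i
  then (2 / #|cell al i|%:R) *: (\sum_(w in cell al i) f w) - f v
  else f v.

Lemma in_cell i v : (v \in cell al i) = (block al v == Some i).
Proof. by rewrite inE. Qed.

Lemma cell_neq0 i : #|cell al i|%:R != 0 :> C.
Proof.
rewrite pnatr_eq0 cards_eq0; apply/set0Pn.
by have [w bw] := block_neq0 al i; exists w; rewrite inE bw.
Qed.

Lemma eq_reflect_cells (W : lmodType C) (f h : V -> W) :
  f =1 h -> reflect_cells f =1 reflect_cells h.
Proof.
move=> fh v; rewrite /reflect_cells fh.
by case: block => // i; under eq_bigr do rewrite fh.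
Qed.

Lemma sum_reflect_cells (W : lmodType C) (f : V -> W) i :
  \sum_(w in cell al i) reflect_cells f w = \sum_(w in cell al i) f w.
Proof.
set S := RHS.
under eq_bigr => w do rewrite /reflect_cells in_cell.
rewrite (eq_bigr (fun w => (2 / #|cell al i|%:R) *: S - f w)) => [|w].
  rewrite sumrB sumr_const -scaler_nat scalerA mulrC divfK ?cell_neq0 //.
  by rewrite -/S scaler_nat mulr2n addrK.
by rewrite in_cell => /eqP ->.
Qed.

Lemma reflect_cellsK (W : lmodType C) (f : V -> W) :
  reflect_cells (reflect_cells f) =1 f.
Proof.
move=> v; rewrite {1}/reflect_cells; case bv: (block al v) => [i|].
  by rewrite sum_reflect_cells /reflect_cells bv subKr.
by rewrite /reflect_cells bv.
Qed.

(** The coefficients of the reflection are real, so that it commutes with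
    adjoints. *)
Lemma reflect_cells_trmxC d (f : V -> 'M[C]_d) v :
  (reflect_cells f v)^t* = reflect_cells (fun w => (f w)^t*) v.
Proof.
rewrite /reflect_cells; case: block => // i.
rewrite linearB /= map_mxB linearZ /= map_mxZ raddf_sum /= raddf_sum.
by congr (_ *: _ - _); rewrite fmorph_div /= !rmorph_nat.
Qed.

(** The matrix of [reflect_cells], that is the scalar matrix behind Q. *)
Definition reflect_coef (u v : V) : C :=
  if block al u is Some i
  then 2 / #|cell al i|%:R * (v \in cell al i)%:R - (u == v)%:R
  else (u == v)%:R.

Lemma sum_reflect_coef (W : lmodType C) (f : V -> W) u :
  \sum_v reflect_coef u v *: f v = reflect_cells f u.
Proof.
have sum_delta : \sum_v (u == v)%:R *: f v = f u.
  rewrite (bigD1 u) //= eqxx scale1r big1 ?addr0 // => v vu.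
  by rewrite eq_sym (negPf vu) scale0r.
rewrite /reflect_coef /reflect_cells; case: block => [i|//].
under eq_bigr do rewrite scalerBl -scalerA.
rewrite sumrB sum_delta -scaler_sumr; congr (_ *: _ - _).
rewrite [RHS]big_mkcond; apply: eq_bigr => v _.
by case: ifP; rewrite ?scale1r ?scale0r.
Qed.

Lemma reflect_coefC u v : reflect_coef u v = reflect_coef v u.
Proof.
rewrite /reflect_coef [v == u]eq_sym.
case bu: (block al u) => [i|]; case bv: (block al v) => [j|] //;
  rewrite !in_cell ?bu ?bv //=.
- by case: eqVneq => [[->]|_]; rewrite ?mulr0.
- by case: eqP bu bv => [->->|]; rewrite // mulr0 subr0.
- by case: eqP bu bv => [->->|]; rewrite // mulr0 subr0.
Qed.

Lemma reflect_coefK u v :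
  \sum_w reflect_coef u w * reflect_coef w v = (u == v)%:R.
Proof.
(* Column v of the matrix is the reflection of the indicator of v. *)
pose delta w : C^o := (w == v)%:R.
have coefE w : reflect_coef w v = reflect_cells delta w.
  rewrite -sum_reflect_coef (bigD1 v) //= /delta eqxx.
  rewrite big1 => [|x /negPf->]; last by rewrite scaler0.
  by rewrite addr0; exact/esym/mulr1.
under eq_bigr do rewrite coefE.
rewrite (sum_reflect_coef (reflect_cells delta : V -> C^o)).
by rewrite reflect_cellsK.
Qed.

End Reflection.

(** * The blocks of the represented adjacency matrices *)

Section Blocks.
Variables (C : numClosedFieldType) (G : groupType) (V : finType) (d : nat).
Variables (pi : representation C G d).
Variables (k : nat) (al : gm_blocks V k) (Ga : gain_graph G V).

Definition rep_gain (Ga : gain_graph G V) (u v : V) : 'M[C]_d :=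
  rep_alg pi (galg0 C (gain0 Ga u v)).

Lemma rep_gainC (H : gain_graph G V) u v : unitary_rep pi ->
  rep_gain H v u = (rep_gain H u v)^t*.
Proof.
move=> U; rewrite /rep_gain /gain0 adj_sym.
case: ifP => [uv|_] /=; last by rewrite !linear0 map_mx0.
by rewrite !rep_algU -unitary_repV // gainV 1?adj_sym.
Qed.

Lemma sum_rep_gain v i :
  \sum_(w in cell al i) rep_gain Ga v w = rep_alg pi (gain_sum C al Ga i v).
Proof.
rewrite /gain_sum big_mkcondr raddf_sum; apply: eq_bigr => w _.
by rewrite /rep_gain /gain0; case: ifP.
Qed.

(** Its linear extension is the augmentation of the group algebra, which counts
    the neighbours of v in C_i when applied to Psi_i(v). *)
Definition trivial_rep : representation C G 1.
Proof. by exists (fun=> 1%:M) => // g h; rewrite mul1mx. Defined.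

Lemma gain_sum_coef v i x :
  (gain_sum C al Ga i v)@_x =
    #|[set w in cell al i | gain0 Ga v w == Some x]|%:R.
Proof.
rewrite /gain_sum raddf_sum -sum1_card natr_sum.
rewrite [LHS]big_mkcond [RHS]big_mkcond; apply: eq_bigr => w _ /=.
rewrite !inE /gain0 mcoeffU; case: (_ == Some i) => //=.
by case: adj => //=; rewrite (inj_eq Some_inj); case: eqP.
Qed.

(** A gain x different from g1 and g2 would give Psi_i(v) a nonzero coefficient
    at x. If g1 and g2 are both group elements, the augmentation of Psi_i(v)
    is |C_i|, so that v is adjacent to all of C_i; otherwise one of them already
    stands for non-adjacency. *)
Lemma balanced_gain v i w (g : option G * option G) :
  balanced C al Ga v i g -> w \in cell al i ->
  gain0 Ga v w = g.1 \/ gain0 Ga v w = g.2.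
Proof.
move=> bal wi; case vw: (gain0 Ga v w) => [x|].
  have [<-|n1] := eqVneq g.1 (Some x); first by left.
  have [<-|n2] := eqVneq g.2 (Some x); first by right.
  have galg0x (y : option G) : y != Some x -> (galg0 C y)@_x = 0.
    case: y => [y|] yx /=; last by rewrite mcoeff0.
    by rewrite mcoeffU -(inj_eq Some_inj) (negPf yx).
  have /eqP := congr1 (mcoeff x) bal.
  rewrite gain_sum_coef mcoeffD !mcoeffZ !galg0x // !mulr0 addr0 pnatr_eq0.
  by rewrite cards_eq0 => /eqP/setP/(_ w); rewrite !inE -in_cell wi vw eqxx.
case: g bal => [[a|] [b|]] bal /=; [|by right|by left|by left].
have := congr1 (rep_alg trivial_rep) bal.
rewrite linearD !linearZ /= !rep_algU /= -scalerDl -splitr.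
rewrite /gain_sum raddf_sum /= (eq_bigr (fun=> 1%:M)); last first.
  by move=> ? _; rewrite rep_algU.
rewrite sumr_const -scaler_nat => /matrixP/(_ 0 0); rewrite !mxE !mulr1.
move/eqP; rewrite eqr_nat => /eqP E.
have sE : [set w in cell al i | adj Ga v w] = cell al i.
  apply/eqP; rewrite eqEcard -E cardsE leqnn andbT.
  by apply/subsetP => ?; rewrite inE => /andP [].
move: wi; rewrite -sE inE => /andP [_ aw].
by move: vw; rewrite /gain0 aw.
Qed.

(** Twice the mean of row v over C_i is pi(g1) + pi(g2) in the balanced case and
    0 in the other one. *)
Lemma rep_gain_switched_C0 s v i w :
  pi s = - 1%:M -> gm_partition al pi Ga ->
  block al v = None -> block al w = Some i ->
  rep_gain (switched C al Ga s) v w = reflect_cells al (rep_gain Ga v) w.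
Proof.
move=> pis [_ gmC0] bv bw.
have wi : w \in cell al i by rewrite in_cell bw.
rewrite /reflect_cells bw sum_rep_gain.
have [[g bal]|nbal] := pselect (exists g, balanced C al Ga v i g).
  rewrite {1}/rep_gain (gain0_switched_balanced s bv bw bal) bal.
  rewrite -scalerDr linearZ scalerA /= mulrA divfK ?cell_neq0 //.
  rewrite divff ?pnatr_eq0 // scale1r linearD /=.
  rewrite /rep_gain /swap.
  case: (balanced_gain bal wi) => ->; first by rewrite eqxx addrAC subrr add0r.
  by rewrite eqxx; case: eqP => [->|_]; rewrite addrK.
have [//|[_ ->]] := gmC0 v i bv; rewrite scaler0 sub0r.
rewrite /rep_gain (gain0_switched_unbalanced s bv bw nbal).
case: (gain0 Ga v w) => [g|] /=; last by rewrite !linear0.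
by rewrite !rep_algU repM pis mulNmx mul1mx.
Qed.

(** Both sides are the sum of all blocks of the C_i x C_j submatrix, computed
    by rows and by columns. *)
Lemma cell_sum_balance i j u v : unitary_rep pi -> gm_partition al pi Ga ->
  u \in cell al i -> v \in cell al j ->
  #|cell al i|%:R *: \sum_(y in cell al j) rep_gain Ga u y =
  #|cell al j|%:R *: \sum_(x in cell al i) rep_gain Ga x v.
Proof.
move=> U [gm _] ui vj.
transitivity (\sum_(x in cell al i) \sum_(y in cell al j) rep_gain Ga x y).
  rewrite scaler_nat -sumr_const; apply: eq_bigr => x xi.
  by rewrite !sum_rep_gain (gm i j u x).
rewrite exchange_big /= scaler_nat -sumr_const; apply: eq_bigr => y yj.
(* The columns are the adjoints of the rows, so their sums are constant too. *)
have colE z : \sum_(x in cell al i) rep_gain Ga x z =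
    (rep_alg pi (gain_sum C al Ga i z))^t*.
  rewrite -sum_rep_gain raddf_sum /= raddf_sum.
  by apply: eq_bigr => x _; rewrite (rep_gainC _ _ _ U).
by rewrite !colE (gm j i y v).
Qed.

(** The entrywise form of the theorem: switching is the reflection in each of
    the two variables. *)
Lemma rep_gain_switched s u v :
  unitary_rep pi -> pi s = - 1%:M -> gm_partition al pi Ga ->
  rep_gain (switched C al Ga s) u v =
  reflect_cells al (fun y => reflect_cells al (rep_gain Ga ^~ y) u) v.
Proof.
move=> U pis gm.
case bu: (block al u) => [i|]; case bv: (block al v) => [j|].
- have ui : u \in cell al i by rewrite in_cell bu.
  have vj : v \in cell al j by rewrite in_cell bv.
  rewrite {1}/rep_gain gain0_switched /switched_gain0 bu bv.
  rewrite {1}/reflect_cells bv.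
  under eq_bigr do rewrite /reflect_cells bu.
  rewrite [in RHS]/reflect_cells bu sumrB -scaler_sumr exchange_big /=.
  rewrite (eq_bigr (fun=> \sum_(y in cell al j) rep_gain Ga u y)); last first.
    move=> x xi; rewrite !sum_rep_gain; case: gm => gm _.
    exact: (gm i j x u).
  rewrite sumr_const -scaler_nat scalerA divfK ?cell_neq0 //.
  rewrite scaler_nat mulr2n addrK opprB.
  (* Of the double reflection there remain twice the row mean, minus twice the
     column mean, plus the original block. *)
  suff -> : (2 / #|cell al j|%:R) *: \sum_(y in cell al j) rep_gain Ga u y =
    (2 / #|cell al i|%:R) *: \sum_(x in cell al i) rep_gain Ga x v.
    by rewrite addrC subrK.
  have := congr1 ( *:%R (2 / #|cell al i|%:R / #|cell al j|%:R))
    (cell_sum_balance U gm ui vj).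
  by rewrite !scalerA mulrAC !divfK ?cell_neq0.
- rewrite {1}/reflect_cells bv rep_gainC // (rep_gain_switched_C0 pis gm bv bu).
  rewrite reflect_cells_trmxC; apply: eq_reflect_cells => x.
  by rewrite -rep_gainC.
- rewrite (rep_gain_switched_C0 pis gm bu bv).
  by apply: eq_reflect_cells => y; rewrite /reflect_cells bu.
- by rewrite /reflect_cells bv bu /rep_gain gain0_switched /switched_gain0 bu bv.
Qed.

Lemma rep_Qmx_entry u v :
  rep_alg pi (Qmx_entry C G al u v) = (reflect_coef C al u v)%:M.
Proof.
rewrite /Qmx_entry /reflect_coef.
case bu: (block al u) => [i|]; case bv: (block al v) => [j|] /=;
  rewrite ?in_cell ?bv /=.
- have [<-|ij] := eqVneq i j; last first.
    rewrite linear0 (_ : _ == _ = false); last first.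
      by apply/eqP => -[ji]; rewrite ji eqxx in ij.
    rewrite mulr0 (_ : u == v = false) ?subrr ?raddf0 //.
    by apply/eqP => uv; move: bv; rewrite -uv bu => -[ji]; rewrite ji eqxx in ij.
  rewrite eqxx mulr1; case: eqP => _; rewrite linearZ /= rep_algU rep1 scalemx1.
    by rewrite mulrBl divff ?cell_neq0.
  by rewrite subr0.
- rewrite linear0 mulr0 (_ : u == v = false) ?subrr ?raddf0 //.
  by apply/eqP => uv; move: bv; rewrite -uv bu.
- rewrite linear0 (_ : u == v = false) ?raddf0 //.
  by apply/eqP => uv; move: bv; rewrite -uv bu.
- by case: eqP; rewrite ?linear0 ?raddf0 // rep_algU rep1.
Qed.

End Blocks.

(** * From blocks to matrices and their spectra *)

Lemma mxblock_scalar1 (C : pzSemiRingType) n d :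
  \mxblock_(i < n, j < n) ((i == j)%:R%:M : 'M[C]_d) = 1%:M.
Proof.
rewrite -[RHS]submxblockK; apply: eq_mxblock => i j; apply/matrixP => a b.
rewrite !mxE -[tagnat.Rank i a == _]val_eqE /= tagnat.eq_Rank val_eqE.
by case: (i == j); rewrite //= mul0rn.
Qed.

Lemma char_poly_conj_involution (C : comNzRingType) m (P A : 'M[C]_m) :
  P *m P = 1%:M -> char_poly (P *m A *m P) = char_poly A.
Proof.
move=> PP; pose Q := map_mx (@polyC C) P.
have QQ : Q *m Q = 1%:M by rewrite -map_mxM PP map_mx1.
have -> : char_poly (P *m A *m P) = \det (Q *m char_poly_mx A *m Q).
  rewrite /char_poly /char_poly_mx mulmxBr mulmxBl -!map_mxM.
  by rewrite scalar_mxC -[_%:M *m Q *m Q]mulmxA QQ mulmx1.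
by rewrite !det_mulmx mulrAC -det_mulmx QQ det1 mul1r.
Qed.

Theorem theorem4p15 (R : realType) (G : groupType) (V : finType)
    (Ga : gain_graph G V) (d : nat) (pi : representation R[i] G d)
    (pi_unitary : unitary_rep pi)
    (s : G) (pi_s : pi s = - 1%:M)
    (k : nat) (al : gm_blocks V k) (al_gm : gm_partition al pi Ga)
    (n : nat) (vord : 'I_n -> V) (vord_bij : bijective vord) :
  rep_mx pi (adjacency_mx R[i] vord (switched R[i] al Ga s)) =
    rep_mx pi (Qmx R[i] G al vord) *m rep_mx pi (adjacency_mx R[i] vord Ga)
      *m rep_mx pi (Qmx R[i] G al vord) /\
  pi_cospectral pi vord Ga vord (switched R[i] al Ga s).
Proof.
have vordP : {on predT, bijective vord} by exact: onW_bij.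
have QE : rep_mx pi (Qmx R[i] G al vord) =
    \mxblock_(i < n, j < n)
      ((reflect_coef R[i] al (vord i) (vord j))%:M : 'M[R[i]]_d).
  by apply: eq_mxblock => i j; rewrite mxE rep_Qmx_entry.
have AE H : rep_mx pi (adjacency_mx R[i] vord H) =
    \mxblock_(i < n, j < n) rep_gain pi H (vord i) (vord j).
  by apply: eq_mxblock => i j; rewrite mxE.
have QQ : rep_mx pi (Qmx R[i] G al vord) *m rep_mx pi (Qmx R[i] G al vord) = 1%:M.
  rewrite QE mul_mxblock -mxblock_scalar1; apply: eq_mxblock => i j.
  under eq_bigr do rewrite -scalar_mxM.
  rewrite -raddf_sum /= -(inj_eq (bij_inj vord_bij)).
  by rewrite -(reflect_coefK R[i] al) [in RHS](reindex vord).
have main : rep_mx pi (adjacency_mx R[i] vord (switched R[i] al Ga s)) =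
    rep_mx pi (Qmx R[i] G al vord) *m rep_mx pi (adjacency_mx R[i] vord Ga)
      *m rep_mx pi (Qmx R[i] G al vord).
  rewrite QE !AE !mul_mxblock; apply: eq_mxblock => i j.
  rewrite (rep_gain_switched _ _ pi_unitary pi_s al_gm) -sum_reflect_coef.
  rewrite (reindex vord) //=; apply: eq_bigr => l _.
  rewrite mul_mx_scalar reflect_coefC; congr (_ *: _).
  rewrite -sum_reflect_coef (reindex vord) //=; apply: eq_bigr => h _.
  by rewrite mul_scalar_mx.
split; first exact: main.
by rewrite /pi_cospectral /pi_spectrum main /spectrum char_poly_conj_involution.
Qed.
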